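(* There is an absolute constant $n_0$ such that for every $k\geq 3$, $q\geq 2$ and $n \geq n_0$ we have $$N_k(q,n)\geq t_{k-2}\!\left(\frac{N_3(q,n)}{3n^q}\right) .$$
   Context: The parameters $k,q,n$ are integers. Let $K^k_N$ denote the complete $k$-uniform hypergraph on the ordered vertex set $\{1,\ldots,N\}$, i.e. all $k$-element subsets of $\{1,\ldots,N\}$. For vertices $x_1<x_2<\cdots<x_{n+k-1}$, the $n$ edges $\{x_i,x_{i+1},\ldots,x_{i+k-1}\}$, $1\le i\le n$, form a monotone path of length $n$ (length is the number of edges). $N_k(q,n)$ is the smallest integer $N$ such that every coloring of the edges of $K^k_N$ with $q$ colors contains a monochromatic monotone path of length $n$ (all $n$ edges having the same color). The tower function $t_k(x)$ (for real $x$) is a tower of exponents (of base $2$) of height $k-1$ with $x$ at the top: $t_1(x)=x$ and $t_k(x)=2^{t_{k-1}(x)}$ for $k\ge 2$ (so $t_3(x)=2^{2^x}$). ''Absolute constant'' means that $n_0$ does not depend on $k$ or $q$. *)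

(* Defs.v *)
From mathcomp Require Import all_boot all_order all_algebra.
From mathcomp Require Import boolp reals exp.
From mathcomp Require Import zify.

Set Implicit Arguments.
Unset Strict Implicit.
Unset Printing Implicit Defensive.

Import Order.TTheory GRing.Theory Num.Theory.

(* The ordered vertex set {1, ..., N} is represented by 'I_N. *)
Definition edge (k N : nat) := {e : {set 'I_N} | #|e| == k}.

Definition coloring (k q N : nat) := {ffun edge k N -> 'I_q}.

Definition increasing (m N : nat) (x : {ffun 'I_m -> 'I_N}) : bool :=
  [forall i : 'I_m, forall j : 'I_m, (i < j) ==> (x i < x j)].

(* With 0-based indices, the i-th edge is {x_i, ..., x_(i + k - 1)}, i < n. *)
Definition path_edge (k n N : nat) (x : {ffun 'I_(n + k - 1) -> 'I_N})
    (i : 'I_n) : {set 'I_N} :=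
  [set x j | j : 'I_(n + k - 1) & i <= j < i + k].

Definition monochromatic (k q n N : nat) (chi : coloring k q N)
    (x : {ffun 'I_(n + k - 1) -> 'I_N}) : bool :=
  [exists c : 'I_q, forall e : edge k N,
     [exists i : 'I_n, val e == path_edge x i] ==> (chi e == c)].

Definition forces_mono_path (k q n N : nat) : bool :=
  [forall chi : coloring k q N,
     exists x : {ffun 'I_(n + k - 1) -> 'I_N},
       increasing x && monochromatic chi x].

(* Finiteness of the Ramsey number, needed to define it as a minimum.
   Vertex sets are encoded here by increasing sequences of naturals, and
   [seq_path k n N g s c] says that s is a monotone path of length n on the
   vertices below N all of whose edges have color c. *)
Definition seq_path (C : Type) (k n N : nat) (g : seq nat -> C)
    (s : seq nat) (c : C) : Prop :=
  [/\ sorted ltn s, all (fun v => v < N) s, size s = n + k - 1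
    & forall i, i < n -> g (take k (drop i s)) = c].

Definition seq_forces (k : nat) : Prop :=
  forall (C : finType) (n : nat), exists N : nat,
    forall g : seq nat -> C, exists s c, seq_path k n N g s c.

Lemma seq_forces1 : seq_forces 1.
Proof.
move=> C n; exists (#|C| * n).+1 => g.
set N := (_ * _).+1.
pose A c := [seq v <- iota 0 N | g [:: v] == c].
have [c hc] : exists c, n <= size (A c).
  apply: contrapT => /forallNP h.
  have: \sum_(c : C) size (A c) <= \sum_(c : C) n.
    by apply: leq_sum => c _; apply: ltnW; rewrite ltnNge; apply/negP/h.
  rewrite sum_nat_const.
  suff -> : \sum_(c : C) size (A c) = N by rewrite ltnn.
  under eq_bigr do rewrite size_filter -sum1_count big_mkcond /=.
  rewrite exchange_big /= -[RHS](size_iota 0) -sum1_size.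
  by apply: eq_bigr => v _; rewrite -big_mkcond /= (big_pred1 (g [:: v])).
have sub : subseq (take n (A c)) (iota 0 N).
  by apply: subseq_trans (take_subseq _ _) (filter_subseq _ _).
exists (take n (A c)), c; split.
- by apply: subseq_sorted sub _; [exact: ltn_trans | exact: iota_ltn_sorted].
- by apply/allP => v /(mem_subseq sub); rewrite mem_iota.
- by rewrite size_takel // addnK.
move=> i lt_in; have hi : i < size (take n (A c)) by rewrite size_takel.
rewrite (drop_nth 0 hi) /= take0.
have: nth 0 (take n (A c)) i \in A c by apply: mem_take (mem_nth _ hi).
by rewrite mem_filter => /andP[/eqP].
Qed.

(* Color each k-set by the lengths of the longest monochromatic paths, for
   each color, that end in it. *)
Lemma seq_forcesS k : 0 < k -> seq_forces k -> seq_forces k.+1.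
Proof.
move=> k_gt0 IH C n.
have [N hN] := IH {ffun C -> 'I_n.+1} 2; exists N => g.
pose Q m s c := exists2 t, seq_path k.+1 m N g t c & drop m t = s.
pose L s := [ffun c => inord (\max_(m < n.+1 | `[< Q m s c >]) m) : 'I_n.+1].
have LE s c : L s c = \max_(m < n.+1 | `[< Q m s c >]) m :> nat.
  by rewrite ffunE inordK // ltnS; apply/bigmax_leqP => m _; rewrite -ltnS.
have [s [d [s_sorted s_lt s_size hs]]] := hN L.
have {s_size} s_size : size s = k.+1 by rewrite s_size; lia.
have := hs 0 isT; rewrite drop0 -(hs 1 isT) drop1 => eqL {hs d}.
case: (lastP s) s_sorted s_lt s_size eqL => // u y.
rewrite size_rcons => s_sorted s_lt [u_size].
rewrite -{1}cats1 take_size_cat // take_oversize; last first.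
  by rewrite size_behead size_rcons u_size.
move=> eqL; set c := g (rcons u y).
have Q0 : Q 0 u c.
  exists u; last by rewrite drop0.
  split=> //; first by apply: subseq_sorted s_sorted; 
    [exact: ltn_trans | exact: subseq_rcons].
  - by move: s_lt; rewrite all_rcons => /andP[].
  - by rewrite u_size; lia.
have [m Qm Lm] : {m : 'I_n.+1 | `[< Q m u c >] & L u c = m :> nat}.
  rewrite LE; apply: eq_bigmax_cond.
  by apply/card_gt0P; exists ord0; apply/asboolP.
move/asboolP: Qm => [t tp t_drop].
have [eq_mn|ne_mn] := eqVneq (m : nat) n; first by exists t, c; rewrite -eq_mn.
have lt_mn : m.+1 < n.+1 by have := ltn_ord m; lia.
case: tp => t_sorted t_lt t_size t_col.
suff /asboolP Qm1 : Q m.+1 (behead (rcons u y)) c.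
  have: m.+1 <= L (behead (rcons u y)) c.
    rewrite LE; exact: (@leq_bigmax_cond _ _ (fun i : 'I_n.+1 => i : nat)
      (Ordinal lt_mn)).
  by rewrite -eqL Lm ltnn.
have et : t = take m t ++ u by rewrite -t_drop cat_take_drop.
have szm : size (take m t) = m by rewrite size_takel // t_size; lia.
have dropy i : i <= size t -> drop i (rcons t y) = rcons (drop i t) y.
  by move=> hi; rewrite -!cats1 drop_cat; case: ltngtP hi => // ->;
     rewrite subnn drop0 drop_size.
exists (rcons t y); last first.
  by rewrite -addn1 addnC -drop_drop dropy ?t_drop ?drop1 // t_size; lia.
split.
- case: (u) u_size s_sorted et => [|a v] /=; first by move=> e; lia.
  rewrite rcons_path => _ /andP[_ lt_y] et.
  move: t_sorted; rewrite {}et; case: (take m t) => [|b w] /= hp.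
    by rewrite rcons_path; apply/andP.
  by rewrite rcons_path last_cat; apply/andP.
- by move: s_lt; rewrite !all_rcons t_lt => /andP[->].
- by rewrite size_rcons t_size; lia.
move=> i; rewrite ltnS leq_eqVlt => /predU1P[->|lt_im].
  by rewrite dropy ?t_drop ?take_oversize // ?size_rcons ?u_size // t_size; lia.
rewrite dropy; last by rewrite t_size; lia.
rewrite -cats1 takel_cat ?t_col // size_drop t_size; lia.
Qed.

Lemma forces_mono_path_ex (k q n : nat) : exists N, forces_mono_path k q n N.
Proof.
have seqN n' : exists s : seq nat, [/\ sorted ltn s, size s = n'
    & all (fun v => v < n') s].
  exists (iota 0 n'); rewrite iota_ltn_sorted size_iota; split=> //.
  by apply/allP => v; rewrite mem_iota.
have seqF : 0 < k -> seq_forces k.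
  elim: k => // -[_ _|k IH _]; first exact: seq_forces1.
  by apply: seq_forcesS => //; apply: IH.
case: q => [|q].
  exists k; apply/forallP => chi.
  have e : #|[set: 'I_k]| == k by rewrite cardsT card_ord.
  by case: (chi (Sub [set: 'I_k] e : edge k k)).
pose h N (chi : coloring k q.+1 N) (s : seq nat) : 'I_q.+1 :=
  if insub [set v : 'I_N | val v \in s] is Some e then chi e else ord0.
have [N hN] : exists N, forall chi : coloring k q.+1 N,
    exists s c, seq_path k n N (h N chi) s c.
  have [k0|k_gt0] := posnP k; last first.
    by have [N hN] := seqF k_gt0 'I_q.+1 n; exists N => chi; apply: hN.
  have [s [s_sorted s_size s_lt]] := seqN (n + k - 1).
  exists (n + k - 1) => chi; exists s, (h _ chi [::]); split=> // i _.
  by rewrite [X in take X]k0 take0.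
exists N; apply/forallP => chi.
have [s [c [s_sorted /allP s_lt s_size s_col]]] := hN chi.
have x_lt (j : 'I_(n + k - 1)) : nth 0 s j < N.
  by apply: s_lt; rewrite mem_nth ?s_size.
pose x := [ffun j => Ordinal (x_lt j)].
apply/existsP; exists x; apply/andP; split.
  apply/forallP => i; apply/forallP => j; apply/implyP => lt_ij.
  by rewrite !ffunE /= (sorted_ltn_nth ltn_trans) ?inE ?s_size.
apply/existsP; exists c; apply/forallP => e; apply/implyP.
move=> /existsP[i /eqP e_i]; rewrite -(s_col i) // /h.
suff -> : [set v : 'I_N | val v \in take k (drop i s)] = val e by rewrite valK.
rewrite e_i; apply/setP => v; rewrite inE; apply/idP/imsetP.
  move=> /(nthP 0)[j]; rewrite size_take_min size_drop s_size => lt_j.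
  rewrite nth_take ?nth_drop; last by lia.
  have lt_ij : i + j < n + k - 1 by lia.
  move=> v_j; exists (Ordinal lt_ij); first by rewrite inE /=; lia.
  by apply: val_inj; rewrite ffunE.
move=> [j]; rewrite inE => /andP[le_ij lt_j] ->; rewrite ffunE /=.
have lt_ij : j - i < size (take k (drop i s)).
  by rewrite size_take_min size_drop s_size; have := ltn_ord j; lia.
apply/(nthP 0); exists (j - i) => //.
by rewrite nth_take ?nth_drop ?subnKC //; lia.
Qed.

(* N_k(q, n), the least N such that every coloring has such a path. *)
Definition ramsey_path (k q n : nat) : nat := ex_minn (forces_mono_path_ex k q n).

Local Open Scope ring_scope.

(* t_k(x): t_1(x) = x and t_k(x) = 2 ^ t_(k-1)(x); t_0 is a junk value. *)
Definition tower (R : realType) (k : nat) (x : R) : R :=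
  iter k.-1 (fun y : R => 2 `^ y) x.

(* Main.v *)
Require Import Defs.
From mathcomp Require Import all_boot all_order all_algebra.
From mathcomp Require Import reals exp.
From mathcomp Require Import zify lra.

Import Order.TTheory GRing.Theory Num.Theory.
Set Implicit Arguments.
Unset Strict Implicit.
Unset Printing Implicit Defensive.

(** Let [n]^q be the grid of vectors of length q with entries below n, ordered
coordinatewise. Given a coloring of the (k+1)-sets without monochromatic
monotone path of length n, label each k-set by the vector of lengths, color by
color, of the longest monochromatic path ending in it; the label of a k-set is
then never above the label of the k-set obtained by deleting its least vertex
and adding a vertex larger than all others. Conversely a labelling of the k-sets with this
property yields such a coloring. So lower bounds for N_{k+1} are labellings of
increasing k-sequences in [n]^q ([is_shift_labelling], [lt_ramsey_path]), and
labels of k-sequences in a set T can be obtained from labels of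
(k-1)-sequences in the sets of elements of T, compared by inclusion of their
down-closures ([shift_labelling_hoare]). After k-1 such steps only the vertices
remain to be labelled, and there it suffices to have a large antichain.

An antichain with w elements has 2^w subsets, which are compared by inclusion;
the most frequent cardinality among them gives an antichain with at least
2^w/(w+1) elements one level up ([antichain_hoare]). Starting from w >= 10 and
w >= 2t, this is at least 2 * 2^t, so the factor 2 absorbs the division by w+1
at every level and the antichains grow like the tower function
([tower_shift_labelling]).

It remains to start the tower one level above [n]^q. Associating with a vertex
v the set of vectors that are not above any label of a pair (v, w), one sees
that N_3 - 1 is at most the number of down-sets of [n]^q ([ramsey_path3_le]).
Since down-sets have at most n^q + 1 cardinalities, and those of the same
cardinality form an antichain, some antichain of down-sets has at least
(N_3 - 1) / (n^q + 1) elements ([downsets_antichain]). If this number is less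
than 10 an explicit antichain of size 10 is used instead ([ten_antichain]),
which exists as soon as n >= 10. In both cases the antichain has at least
2 N_3 / (3 n^q) elements. *)

(** * Labellings of the shift graph *)

(** A homomorphism from the shift graph, whose arcs lead from
(x_0, ..., x_(k-1)) to (x_1, ..., x_k), to the digraph on T with an arc from
a to b unless b is below a. *)
Definition is_shift_labelling (T : finType) (r : rel T) (k N : nat)
    (f : seq nat -> T) : Prop :=
  forall s, sorted ltn s -> all (fun v => v < N) s -> size s = k.+1 ->
    ~~ r (f (behead s)) (f (take k s)).

(** When r is a preorder this is inclusion of down-closures, so that {set T}
stands for the lattice of down-sets of T. Using arbitrary sets avoids a new
carrier type, and thus makes the construction easy to iterate. *)
Definition hoare (T : finType) (r : rel T) : rel {set T} :=
  fun A B => [forall a in A, [exists b in B, r a b]].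

Definition antichain (T : finType) (r : rel T) (A : {set T}) : Prop :=
  {in A &, forall x y, r x y -> x = y}.

(** An increasing (k+1)-sequence contains two consecutive k-sequences, with
labels A and then B, and the hypothesis gives an element of B that lies below
no element of A: this is the new label. For the next (k+1)-sequence B plays the
role of A, so its label lies below no element of B, in particular not below
the previous label. *)
Lemma shift_labelling_hoare (T : finType) (r : rel T) (x0 : T) k N f :
  is_shift_labelling (hoare r) k N f ->
  exists g, is_shift_labelling r k.+1 N g.
Proof.
move=> fP.
pose fresh s b := (b \in f (behead s)) && [forall a in f (take k s), ~~ r b a].
pose g s := odflt x0 [pick b | fresh s b].
have gP s : sorted ltn s -> all (fun v => v < N) s -> size s = k.+1 ->
    fresh s (g s).
  move=> s_sorted s_lt s_size; rewrite /g; case: pickP => //= none.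
  have /forall_inPn[b b_in /exists_inPn b_out] := fP s s_sorted s_lt s_size.
  by have /andP[] := none b; split=> //; apply/forall_inP.
exists g => s s_sorted s_lt s_size.
have s1_size : size (take k.+1 s) = k.+1 by rewrite size_takel // s_size.
have s2_size : size (behead s) = k.+1 by rewrite size_behead s_size.
have /andP[g1 _] : fresh (take k.+1 s) (g (take k.+1 s)).
  apply: gP => //; first exact: take_sorted.
  by apply/allP => v /mem_take; apply: (allP s_lt).
have /andP[_ /forall_inP g2] : fresh (behead s) (g (behead s)).
  apply: gP => //; first by rewrite -drop1; apply: drop_sorted.
  by apply/allP => v /mem_behead; apply: (allP s_lt).
apply: g2.
by case: (s) g1.
Qed.

Lemma shift_labelling_antichain (T : finType) (r : rel T) (x0 : T) A :
  antichain r A -> exists f, is_shift_labelling r 1 #|A| f.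
Proof.
move=> Aanti; exists (fun s => nth x0 (enum A) (head 0 s)).
case=> [|u [|v []]] //= /andP[lt_uv _] /and3P[u_lt v_lt _] _.
have inA i : i < #|A| -> nth x0 (enum A) i \in A.
  by move=> iA; rewrite -mem_enum mem_nth // -cardE.
apply/negP => /(Aanti _ _ (inA _ v_lt) (inA _ u_lt)) /eqP.
by rewrite nth_uniq ?enum_uniq -?cardE // gtn_eqF.
Qed.

(** * Antichains of sets *)

Lemma exists_large_fiber (T : finType) (F : {set T}) (f : T -> nat) m :
  {in F, forall x, f x <= m} ->
  exists i, #|F| <= #|[set x in F | f x == i]| * m.+1.
Proof.
move=> f_le; pose fiber (i : 'I_m.+1) := #|[set x in F | f x == i]|.
have m_gt0 : 0 < #|'I_m.+1| by rewrite card_ord.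
have [i iP] := bigop.eq_bigmax fiber m_gt0.
exists (val i); rewrite -/(fiber i) -iP mulnC -[X in X * _](card_ord m.+1).
rewrite -sum_nat_const; apply: leq_trans (_ : \sum_j fiber j <= _); last first.
  by apply: leq_sum => j _; apply: (bigop.leq_bigmax (F := fiber)).
rewrite -sum1_card (partition_big (fun x => inord (f x) : 'I_m.+1) xpredT) //=.
apply: leq_sum => j _; rewrite sum1dep_card; apply/subset_leq_card/subsetP => x.
by rewrite !inE => /andP[xF /eqP <-]; rewrite xF inordK ?eqxx // ltnS f_le.
Qed.

(** Distinct sets of equal cardinality are not included in each other, and
there are only m+1 cardinalities. *)
Lemma antichain_hoare_of_inclusion (T : finType) (r : rel T)
    (F : {set {set T}}) m :
  {in F &, forall X Y, hoare r X Y -> X \subset Y} ->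
  {in F, forall X : {set T}, #|X| <= m} ->
  exists2 B : {set {set T}}, antichain (hoare r) B & #|F| <= #|B| * m.+1.
Proof.
move=> F_incl F_le.
have [i iP] := exists_large_fiber (f := fun X : {set T} => #|X|) F_le.
exists [set X in F | #|X| == i] => // X Y.
rewrite !inE => /andP[XF /eqP Xi] /andP[YF /eqP Yi] XY.
by apply/eqP; rewrite eqEcard F_incl // Xi Yi leqnn.
Qed.

Lemma antichain_hoare (T : finType) (r : rel T) A :
  antichain r A ->
  exists2 B : {set {set T}}, antichain (hoare r) B
    & 2 ^ #|A| <= #|B| * #|A|.+1.
Proof.
move=> Aanti; rewrite -card_powerset; apply: antichain_hoare_of_inclusion.
  move=> X Y; rewrite !inE => /subsetP XA /subsetP YA /forall_inP XY.
  apply/subsetP => x xX; have /exists_inP[y yY rxy] := XY x xX.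
  by rewrite (Aanti x y (XA _ xX) (YA _ yY) rxy).
by move=> X; rewrite inE; apply: subset_leq_card.
Qed.

(** * Labels in the grid from the lengths of monochromatic paths *)

Definition grid (q n : nat) : finType := {ffun 'I_q -> 'I_n}.

Definition grid_le (q n : nat) : rel (grid q n) :=
  fun x y => [forall c, x c <= y c].

Lemma grid_le_trans q n : transitive (@grid_le q n).
Proof.
move=> y x z /forallP xy /forallP yz.
by apply/forallP => c; apply: leq_trans (xy c) (yz c).
Qed.

Definition downsets (q n : nat) : {set {set grid q n}} :=
  [set D : {set grid q n} |
     [forall y in D, forall x : grid q n, grid_le x y ==> (x \in D)]].

Fixpoint ends_walk (E : finType) (e : rel E) m y :=
  if m is m'.+1 then [exists x, ends_walk e m' x && e x y] else true.

Definition walk_rank (E : finType) (e : rel E) n (x : E) : 'I_n.+1 :=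
  [arg max_(m > ord0 | ends_walk e m x) (m : nat)].

(** A walk realizing the rank of x extends to y by one step. Ranks only count
walks of at most n steps, so longer walks to y have to be excluded. *)
Lemma walk_rank_lt (E : finType) (e : rel E) n x y :
  ~~ ends_walk e n.+1 y -> e x y -> walk_rank e n x < walk_rank e n y.
Proof.
move=> no_walk exy; rewrite {1}/walk_rank.
case: arg_maxnP => // i xi _; rewrite /walk_rank.
case: arg_maxnP => // j _ jP.
have yi : ends_walk e i.+1 y by apply/existsP; exists x; apply/andP.
have lt_in : i.+1 < n.+1.
  rewrite ltn_neqAle ltn_ord andbT; apply: contraNneq no_walk => <-.
  exact: yi.
exact: (jP (Ordinal lt_in)).
Qed.

Section TripleColoring.
Variables (q n N : nat) (chi : coloring 3 q N).

(** Monotone paths of color c are the walks of this relation between pairs. *)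
Definition triple_step (c : 'I_q) : rel ('I_N * 'I_N) := fun x y =>
  [&& x.2 == y.1, x.1 < x.2 & [exists e : edge 3 N,
     (val e == [set x.1; x.2; y.2]) && (chi e == c)]].

Lemma ends_walk_path c m x :
  ends_walk (triple_step c) m x -> x.1 < x.2 ->
  exists h : nat -> 'I_N, [/\ h m = x.1, h m.+1 = x.2,
     forall i j, i < j -> j <= m.+1 -> h i < h j
   & forall i, i < m -> exists e : edge 3 N,
       val e = [set h i; h i.+1; h i.+2] /\ chi e = c].
Proof.
elim: m x => [|m IH] [u v] /=.
  move=> _ lt_uv; exists (fun i => if i is 0 then u else v).
  by split=> // -[|i] [|[|j]].
move=> /existsP[[t u'] /andP[walk /and3P[/= /eqP eu lt_tu /existsP[e]]]].
move=> /andP[/eqP e_val /eqP e_col] lt_uv; rewrite {}eu in walk lt_tu e_val *.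
have [h [ht hu h_inc h_col]] := IH _ walk lt_tu.
exists (fun i => if i <= m.+1 then h i else v); split=> /=.
- by rewrite leqnn.
- by rewrite ltnn.
- move=> i j lt_ij le_jm; have -> : i <= m.+1 by lia.
  case: ifP => [|gt_jm]; first exact: h_inc.
  have [->|ne_im] := eqVneq i m.+1; first by rewrite hu.
  apply: leq_trans lt_uv; rewrite ltnS ltnW // -[u]hu; apply: h_inc => //; lia.
move=> i le_im; have [->|ne_im] := eqVneq i m.
  by exists e; rewrite leqnSn ltnSn ltnn ht hu.
have [lt_im -> -> ->] : [/\ i < m, i <= m.+1, i < m.+1 & i.+1 < m.+1].
  by split; lia.
exact: h_col.
Qed.

Lemma no_long_walk :
  ~~ [exists x : {ffun 'I_(n + 3 - 1) -> 'I_N},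
        increasing x && monochromatic chi x] ->
  forall c (x : 'I_N * 'I_N), x.1 < x.2 -> ~~ ends_walk (triple_step c) n x.
Proof.
move=> no_path c x lt_x; apply: contra no_path => /ends_walk_path/(_ lt_x).
move=> [h [_ _ h_inc h_col]]; apply/existsP.
exists [ffun j : 'I_(n + 3 - 1) => h j].
apply/andP; split.
  apply/forallP => i; apply/forallP => j; apply/implyP => lt_ij.
  by rewrite !ffunE; apply: h_inc => //; have := ltn_ord j; lia.
apply/existsP; exists c; apply/forallP => e; apply/implyP.
move=> /existsP[i /eqP e_i]; have [e' [e'_val e'_col]] := h_col i (ltn_ord i).
suff -> : e = e' by rewrite e'_col.
apply: val_inj; rewrite e_i e'_val; apply/setP => v; rewrite !inE.
apply/imsetP/idP => [[j] | hv].
  rewrite inE ffunE => /andP[le_ij lt_ji] ->.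
  have : [|| (j : nat) == i, (j : nat) == i.+1 | (j : nat) == i.+2] by lia.
  by case/or3P => /eqP ->; rewrite eqxx ?orbT.
have [j j_in ->] : exists2 j : nat, i <= j < i + 3 & v = h j.
  case/orP: hv => [/orP[]|] /eqP ->; [exists i|exists i.+1|exists i.+2] => //; lia.
have lt_j : j < n + 3 - 1 by have := ltn_ord i; lia.
by exists (Ordinal lt_j); rewrite ?inE ?ffunE.
Qed.
End TripleColoring.

(** The label L u v of a pair is never above the label L v w of a later one. So
the set D v of vectors that are above no L v w contains L u v for all u < v,
while D u does not contain L u v: the down-sets D v are distinct. *)
Lemma vertices_le_downsets q n N (chi : coloring 3 q N) :
  ~~ [exists x : {ffun 'I_(n.+1 + 3 - 1) -> 'I_N},
        increasing x && monochromatic chi x] ->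
  N <= #|downsets q n.+1|.
Proof.
move=> no_path.
pose L (u v : 'I_N) : grid q n.+1 :=
  [ffun c => walk_rank (triple_step chi c) n (u, v)].
have LP (u v w : 'I_N) : u < v -> v < w -> ~~ grid_le (L v w) (L u v).
  move=> lt_uv lt_vw.
  have e_card : #|[set u; v; w]| == 3.
    rewrite -setUA cardsU1 cards2 !inE -!(inj_eq val_inj) /=; lia.
  set e : edge 3 N := Sub [set u; v; w] e_card.
  apply/forallPn; exists (chi e); rewrite -ltnNge !ffunE.
  apply: walk_rank_lt; first exact: no_long_walk.
  by apply/and3P; split=> //=; apply/existsP; exists e; rewrite !eqxx.
pose D (v : 'I_N) :=
  [set x : grid q n.+1 | [forall w : 'I_N, (v < w) ==> ~~ grid_le (L v w) x]].
have D_down v : D v \in downsets q n.+1.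
  rewrite inE; apply/forall_inP => y; rewrite inE => /forallP yP.
  apply/forallP => x; apply/implyP => le_xy; rewrite inE; apply/forallP => w.
  apply/implyP => lt_vw; apply: contra (implyP (yP w) lt_vw) => le_x.
  exact: grid_le_trans le_x le_xy.
have D_neq (u v : 'I_N) : u < v -> D u != D v.
  move=> lt_uv; apply/negP => /eqP/setP/(_ (L u v)); rewrite !inE.
  have -> : [forall w : 'I_N, (v < w) ==> ~~ grid_le (L v w) (L u v)].
    by apply/forallP => w; apply/implyP; apply: LP.
  move=> /forallP/(_ v); rewrite lt_uv /= => /negP; apply.
  by apply/forallP => c.
have D_inj : injective D.
  move=> u v Duv; have [lt_uv|lt_vu|/ord_inj //] := ltngtP u v.
    by have := D_neq u v lt_uv; rewrite Duv eqxx.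
  by have := D_neq v u lt_vu; rewrite Duv eqxx.
rewrite -[N]card_ord -(card_imset _ D_inj).
by apply/subset_leq_card/subsetP => _ /imsetP[v _ ->].
Qed.

Lemma ramsey_path3_le q n : ramsey_path 3 q n.+1 <= #|downsets q n.+1|.+1.
Proof.
rewrite /ramsey_path; case: ex_minnP => N0 _; apply.
apply/forallP => chi; apply/contraT => /vertices_le_downsets.
by rewrite ltnn.
Qed.

(** * Colorings from labels in the grid *)

(** Color each (k+1)-set by a coordinate in which the label increases from its
first to its last k elements. Along a path of color c the c-th coordinate then
takes n+1 increasing values below n. *)
Lemma lt_ramsey_path k q n N (f : seq nat -> grid q.+1 n) :
  is_shift_labelling (@grid_le q.+1 n) k N f -> N < ramsey_path k.+1 q.+1 n.
Proof.
move=> fP; rewrite /ramsey_path; case: ex_minnP => m /forallP m_forces _.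
rewrite ltnNge; apply/negP => le_mN.
pose ups s := [pick c | f (take k s) c < f (behead s) c].
have upsP s : sorted ltn s -> all (fun v => v < m) s -> size s = k.+1 ->
    f (take k s) (odflt ord0 (ups s)) < f (behead s) (odflt ord0 (ups s)).
  move=> s_sorted s_lt s_size; rewrite /ups; case: pickP => //= none.
  have s_lt' : all (fun v => v < N) s.
    by apply: sub_all s_lt => v /leq_trans; apply.
  have /forallPn[c] := fP s s_sorted s_lt' s_size.
  by rewrite -ltnNge; have /= -> := none c.
pose elems (A : {set 'I_m}) := [seq val v | v <- enum A].
have elems_sorted A : sorted ltn (elems A).
  rewrite /elems; apply: (subseq_sorted ltn_trans) (iota_ltn_sorted 0 m).
  by rewrite -val_enum_ord map_subseq // enumT; apply: filter_subseq.
pose chi : coloring k.+1 q.+1 m :=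
  [ffun e => odflt ord0 (ups (elems (val e)))].
have /existsP[x /andP[/forallP x_inc /existsP[c /forallP cP]]] := m_forces chi.
pose xs := [seq val (x j) | j <- enum 'I_(n + k.+1 - 1)].
have xs_size : size xs = n + k by rewrite size_map size_enum_ord; lia.
have xs_nth (j : 'I_(n + k.+1 - 1)) : nth 0 xs j = x j.
  by rewrite (nth_map j) ?size_enum_ord ?nth_ord_enum.
have xs_sorted : sorted ltn xs.
  apply/(sortedP 0) => i; rewrite xs_size => lt_i.
  have [i1 i2] : i < n + k.+1 - 1 /\ i.+1 < n + k.+1 - 1 by lia.
  rewrite (xs_nth (Ordinal i1)) (xs_nth (Ordinal i2)).
  by have /forallP/(_ (Ordinal i2))/implyP := x_inc (Ordinal i1); apply.
have xs_lt : all (fun v => v < m) xs by apply/allP => _ /mapP[j _ ->] /=.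
pose win l i := take l (drop i xs).
have win_edge (i : 'I_n) : elems (path_edge x i) = win k.+1 i.
  apply: (irr_sorted_eq ltn_trans ltnn) => //; first exact/take_sorted/drop_sorted.
  have lt_in := ltn_ord i.
  move=> v; apply/mapP/idP => [[w]|].
    rewrite mem_enum => /imsetP[j]; rewrite inE => /andP[le_ij lt_ji] -> ->.
    apply/(nthP 0); exists (j - i).
      by rewrite size_take_min size_drop xs_size; have := ltn_ord j; lia.
    by rewrite nth_take ?nth_drop ?subnKC ?xs_nth //; lia.
  move=> /(nthP 0)[l]; rewrite size_take_min size_drop xs_size => lt_l.
  have lt_il : i + l < n + k.+1 - 1 by lia.
  rewrite nth_take ?nth_drop; last by lia.
  rewrite (xs_nth (Ordinal lt_il)) => <-.
  exists (x (Ordinal lt_il)) => //; rewrite mem_enum; apply: imset_f.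
  by rewrite inE /=; lia.
have win_size l i : i + l <= n + k -> size (win l i) = l.
  by move=> le_il; rewrite size_takel // size_drop xs_size; lia.
have win_lt i : i < n -> f (win k i) c < f (win k i.+1) c.
  move=> lt_in; pose i' := Ordinal lt_in.
  have e_card : #|path_edge x i'| == k.+1.
    by rewrite cardE -(size_map val) -/(elems _) win_edge win_size //=; lia.
  set e : edge k.+1 m := Sub (path_edge x i') e_card.
  have : chi e == c.
    by move/implyP: (cP e); apply; apply/existsP; exists i'; rewrite eqxx.
  rewrite ffunE win_edge /= => /eqP chi_e.
  have := upsP (win k.+1 i); rewrite chi_e.
  have -> : take k (win k.+1 i) = win k i by rewrite take_takel.
  have -> : behead (win k.+1 i) = win k i.+1.
    by rewrite -drop1 /win -[k.+1]addn1 -take_drop drop_drop.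
  apply; first exact/take_sorted/drop_sorted.
    by apply/allP => v /mem_take/mem_drop; apply: (allP xs_lt).
  by rewrite win_size //; lia.
have win_ge i : i <= n -> i <= f (win k i) c.
  elim: i => // i IH lt_in.
  exact: leq_ltn_trans (IH (ltnW lt_in)) (win_lt i lt_in).
by have := win_ge n (leqnn n); rewrite leqNgt ltn_ord.
Qed.

(** * Antichains of sets of grid vectors *)

Lemma downsets_antichain q n :
  exists2 B : {set {set grid q n}}, antichain (hoare (@grid_le q n)) B
    & #|downsets q n| <= #|B| * (n ^ q).+1.
Proof.
apply: antichain_hoare_of_inclusion => [X Y _|X _].
  rewrite inE => /forall_inP Ydown /forall_inP XY; apply/subsetP => x xX.
  have /exists_inP[y yY le_xy] := XY x xX.
  by move/forallP: (Ydown y yY) => /(_ x)/implyP; apply.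
apply: leq_trans (max_card _) _.
by rewrite card_ffun !card_ord.
Qed.

(** The vectors (i, 9 - i, ..., 9 - i), i < 10, are pairwise incomparable. *)
Lemma ten_antichain q n : 10 <= n ->
  exists2 B : {set {set grid q.+2 n}}, antichain (hoare (@grid_le q.+2 n)) B
    & #|B| = 10.
Proof.
case: n => // n n_ge.
pose p (i : 'I_10) : grid q.+2 n.+1 :=
  [ffun c => inord (if c == ord0 then i : nat else 9 - i)].
have p_le i j : hoare (@grid_le q.+2 n.+1) [set p i] [set p j] -> i = j.
  move=> /forall_inP/(_ _ (set11 _))/exists_inP[_ /set1P -> /forallP le_ij].
  have [lt_i lt_j] := (ltn_ord i, ltn_ord j).
  have := le_ij ord0; have := le_ij ord_max; rewrite !ffunE /= !inordK; try lia.
  by move=> ? ?; apply/val_inj => /=; lia.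
exists [set [set p i] | i in 'I_10].
  by move=> _ _ /imsetP[i _ ->] /imsetP[j _ ->] /p_le ->.
rewrite card_imset ?card_ord // => i j eq_ij; apply: p_le; rewrite eq_ij.
apply/forall_inP => x xj; apply/exists_inP; exists x => //.
by apply/forallP => c.
Qed.

(** * Growth of the antichains *)

Lemma quadratic_le_exp2 w : 10 <= w -> 4 * w.+1 ^ 2 <= 2 ^ w.
Proof.
elim: w => // w IH; rewrite leq_eqVlt => /predU1P[<- //|w_ge].
by have := IH w_ge; rewrite [2 ^ _.+1]expnS; nia.
Qed.

(** With m >= 2^w / (w+1), this says that m >= 2 * 2^(w/2); squaring keeps the
exponent an integer. *)
Lemma exp2_le_square w m : 10 <= w -> 2 ^ w <= m * w.+1 -> 4 * 2 ^ w <= m ^ 2.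
Proof.
move=> w_ge le_m; have := quadratic_le_exp2 w_ge.
rewrite -(leq_pmul2r (_ : 0 < w.+1 ^ 2)) //.
by have := leq_mul le_m le_m; nia.
Qed.

Local Open Scope ring_scope.

(** The invariant |A| >= 2t is preserved by passing to sets, with 2 ^ t in place
of t, provided that |A| >= 10. *)
Lemma tower_shift_labelling (R : realType) j (T : finType) (r : rel T) (x0 : T)
    (A : {set T}) (t : R) :
  antichain r A -> (10 <= #|A|)%N -> 2 * t <= #|A|%:R ->
  exists N f, is_shift_labelling r j.+1 N f /\ 2 * tower j.+1 t <= N%:R.
Proof.
elim: j T r x0 A t => [|j IH] T r x0 A t Aanti A_ge tA.
  by have [f fP] := shift_labelling_antichain x0 Aanti; exists #|A|, f.
have [B Banti B_ge] := antichain_hoare Aanti.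
have B_sq := exp2_le_square A_ge B_ge.
have B10 : (10 <= #|B|)%N.
  have : (2 ^ 10 <= 2 ^ #|A|)%N by rewrite leq_exp2l.
  by rewrite [X in (X <= _)%N]/=; nia.
have tB : 2 * 2 `^ t <= #|B|%:R :> R.
  rewrite -(@ler_pXn2r _ 2) ?nnegrE ?mulr_ge0 ?powR_ge0 //.
  rewrite exprMn [X in _ * X <= _]expr2 -powRD; last by rewrite pnatr_eq0 implybT.
  apply: (@le_trans _ _ (4 * 2 ^+ #|A|)); last first.
    by rewrite -!natrX -natrM ler_nat.
  have -> : 2 ^+ 2 = 4 :> R by rewrite -natrX.
  rewrite ler_pM2l ?ltr0n // -powR_mulrn // ler_powR ?ler1n //.
  by lra.
have [N [f [fP fN]]] := IH {set T} (hoare r) set0 B (2 `^ t) Banti B10 tB.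
have [g gP] := shift_labelling_hoare x0 fP.
by exists N, g; split=> //; move: fN; rewrite /tower /= -iterSr.
Qed.

Theorem theorem4 :
  exists n0 : nat, forall (R : realType) (k q n : nat),
    (3 <= k)%N -> (2 <= q)%N -> (n0 <= n)%N ->
    tower (k - 2) ((ramsey_path 3 q n)%:R / (3 * n%:R ^+ q))
      <= (ramsey_path k q n)%:R :> R.
Proof.
exists 10 => R [|[|[|k]]] // [|[|q]] // n _ _ n_ge.
have [B Banti [B_ge B_down]] : exists2 B : {set {set grid q.+2 n}},
    antichain (hoare (@grid_le q.+2 n)) B
    & (10 <= #|B|)%N /\ (#|downsets q.+2 n| <= #|B| * (n ^ q.+2).+1)%N.
  have [B Banti B_down] := downsets_antichain q.+2 n.
  have [B_ge|B_lt] := leqP 10 #|B|; first by exists B.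
  (* The bound on the number of down-sets survives passing to a larger set. *)
  have [B' B'anti B'10] := ten_antichain q n_ge; exists B' => //.
  by rewrite B'10; split=> //; apply: leq_trans B_down _; rewrite leq_mul // ltnW.
case: n n_ge B Banti B_ge B_down => // n n_ge B Banti B_ge B_down.
set t : R := _ / _.
have tB : 2 * t <= #|B|%:R.
  have X_ge : (10 <= n.+1 ^ q.+2)%N.
    by apply: leq_trans n_ge _; rewrite expnS leq_pmulr // expn_gt0.
  rewrite /t -natrX -natrM mulrA ler_pdivrMr; last by rewrite ltr0n; lia.
  rewrite -!natrM ler_nat.
  (* With X = n ^ q and b = #|B| this is 2 (b (X + 1) + 1) <= 3 b X. *)
  have := ramsey_path3_le q.+2 n; nia.
have [N [f [fP fN]]] := tower_shift_labelling k set0 Banti B_ge tB.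
have [g gP] := shift_labelling_hoare [ffun=> ord0] fP.
have := lt_ramsey_path gP; rewrite -(ltr_nat R).
have : (0 <= N%:R :> R) by exact: ler0n.
rewrite !subSS subn0 => N_ge0; lra.
Qed.
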